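(* For all $u,w\in S_\infty$, \[ \langle \mathfrak S_u,\ \mathfrak D_{1,w}\rangle=\delta_{uw}. \] Equivalently, the chain-defined polynomials $\mathfrak D_{1,w}$ coincide with the dual Schubert polynomials $\mathfrak D_w$, i.e. the polynomials dual to the Schubert polynomials under $\langle\cdot,\cdot\rangle$.
   Context: $S_\infty$ is the group of permutations of $\mathbb P=\{1,2,\dots\}$ fixing all but finitely many elements. It is generated by $s_i=(i,i+1)$. The length $\ell(w)$ is the minimal number of simple transpositions in an expression for $w$, and $\mathrm{Red}(w)$ is the set of reduced words $(a_1,\dots,a_p)$ with $w=s_{a_1}\cdots s_{a_p}$ and $p=\ell(w)$. Bruhat covers: $u\to v$ means $v=u\,(a,b)$ for some $a<b$ (right multiplication by the transposition $(a,b)$) and $\ell(v)=\ell(u)+1$. Set $\mu(u\to v)=x_a-x_b$. Schubert polynomials (Billey–Jockusch–Stanley): $\mathfrak S_w=\sum x_{i_1}\cdots x_{i_p}$. The sum runs over pairs consisting of $(a_1,\dots,a_p)\in\mathrm{Red}(w)$ and $i_1\le\dots\le i_p$ such that $i_j\le a_j$ for all $j$, and $i_j=i_{j+1}$ only if $a_j<a_{j+1}$. Inner product on $\mathbb C[x_1,x_2,\dots]$: \[ \langle f,g\rangle=f(\partial/\partial x_1,\partial/\partial x_2,\dots)\,g(x_1,x_2,\dots)\big|_{x_1=x_2=\dots=0}. \] For $u,w\in S_\infty$, the skew dual Schubert polynomial is \[ \mathfrak D_{u,w}=\frac1{p!}\sum_{u=v_0\to v_1\to\dots\to v_p=w}\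 \prod_{i=1}^p\mu(v_{i-1}\to v_i), \] summed over all saturated Bruhat chains from $u$ to $w$. Here $p=\ell(w)-\ell(u)$, and $\mathfrak D_{u,w}=0$ if there is no such chain.
   Formalization: The condition in the Schubert polynomial formula is corrected to ''i_j = i_{j+1} only if a_j > a_{j+1}'' (as printed, 𝔖_u = 0 for u = s_2 s_1 and the claim fails); S_∞ is treated as the union of all S_n, and coefficients are rational instead of complex. *)

(* Defs.v *)
From HB Require Import structures.
From mathcomp Require Import all_boot all_order all_algebra all_fingroup.
From mathcomp Require Import mpoly.
From Stdlib Require Import ClassicalEpsilon.

Set Implicit Arguments.
Unset Strict Implicit.
Unset Printing Implicit Defensive.

Import GRing.Theory.
Local Open Scope ring_scope.

(* Conventions.  We work in S_n (any n), viewed inside S_oo.  The point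
   k+1 of P = {1,2,...} is encoded by the ordinal k : 'I_n, and the
   variable x_{k+1} by 'X_k in {mpoly rat[n]}.
   MathComp multiplies permutations left-to-right: (p * q) x = q (p x).
   So the functional composition "u o v" is  v * u  in MathComp. *)

Section Schubert.
Variable n : nat.

Definition pred_ord (a : 'I_n) : 'I_n :=
  Ordinal (leq_ltn_trans (leq_pred a) (ltn_ord a)).

(* the simple transposition s_a = (a, a+1), for a letter a with 1 <= a <= n-1
   (as 1-based letter); in 0-based positions it swaps a-1 and a. *)
Definition stp (a : 'I_n) : {perm 'I_n} :=
  if (0 < a)%N then tperm (pred_ord a) a else 1%g.

(* word_perm [:: a1; ...; ap] = s_{a1} o s_{a2} o ... o s_{ap} (composition) *)
Definition word_perm (s : seq 'I_n) : {perm 'I_n} :=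
  foldr (fun a acc => (acc * stp a)%g) 1%g s.

Definition is_word (w : {perm 'I_n}) (s : seq 'I_n) : bool :=
  all (fun a : 'I_n => (0 < a)%N) s && (word_perm s == w).

Definition has_word_of_size (w : {perm 'I_n}) (p : nat) : bool :=
  [exists t : p.-tuple 'I_n, is_word w t].

Definition perm_length (w : {perm 'I_n}) : nat :=
  match excluded_middle_informative (exists p, has_word_of_size w p) with
  | left H => ex_minn H
  | right _ => 0%N
  end.

Definition is_reduced_word (w : {perm 'I_n}) (s : seq 'I_n) : bool :=
  is_word w s && (size s == perm_length w).

(* BJS compatible sequences.  a = letters (1-based), j = 0-based variable
   indices (i_k = j_k + 1):  i_1 <= ... <= i_p,  i_k <= a_k,
   and i_k = i_{k+1} only if a_k > a_{k+1}. *)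
Definition compatible (a j : seq nat) : bool :=
  [&& size a == size j,
      all (fun k => nth 0%N j k < nth 0%N a k)%N (iota 0 (size a)) &
      all (fun k => (nth 0%N j k <= nth 0%N j k.+1)%N &&
                    ((nth 0%N j k == nth 0%N j k.+1) ==>
                     (nth 0%N a k.+1 < nth 0%N a k)%N))
          (iota 0 (size a).-1)].

(* Schubert polynomial (Billey--Jockusch--Stanley formula) *)
Definition schubert (w : {perm 'I_n}) : {mpoly rat[n]} :=
  \sum_(t : (perm_length w).-tuple 'I_n | is_reduced_word w t)
    \sum_(j : (perm_length w).-tuple 'I_n |
            compatible (map val t) (map val j))
      \prod_(k <- j) 'X_k.

(* Sum over saturated Bruhat chains u = v_0 -> ... -> v_p = w of the product
   of the weights mu(v_{i-1} -> v_i) = x_a - x_b, where v_i = v_{i-1} (a,b),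
   a < b (right multiplication by the transposition (a,b), i.e. the
   composition v_{i-1} o (a,b) = tperm a b * v_{i-1} in MathComp).  A
   saturated chain is indexed by its successive transpositions (a,b). *)
Fixpoint chain_sum (p : nat) (u w : {perm 'I_n}) : {mpoly rat[n]} :=
  match p with
  | 0%N => (u == w)%:R
  | p'.+1 =>
      \sum_(a : 'I_n) \sum_(b : 'I_n |
            (a < b)%N &&
            (perm_length (tperm a b * u)%g == (perm_length u).+1))
        ('X_a - 'X_b) * chain_sum p' (tperm a b * u)%g w
  end.

Definition skew_dual_schubert (u w : {perm 'I_n}) : {mpoly rat[n]} :=
  let p := (perm_length w - perm_length u)%N in
  ((p`!)%:R)^-1 *: chain_sum p u w.

(* <f, g> = f(d/dx_1, ..., d/dx_n) g evaluated at x = 0 *)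
Definition diff_pairing (f g : {mpoly rat[n]}) : rat :=
  \sum_(m <- msupp f) f@_m * (mderivm m g)@_0.

End Schubert.

(* Main.v *)
Require Import Defs.
From HB Require Import structures.
From mathcomp Require Import all_boot all_order all_algebra all_fingroup.
From mathcomp Require Import mpoly zify.

Set Implicit Arguments.
Unset Strict Implicit.
Unset Printing Implicit Defensive.

Import GRing.Theory.
Local Open Scope ring_scope.

(** Write d_a for the divided differences and e(f) for the constant term of f.
    Let J be the ideal of all f with e(d_a1 ... d_ap f) = 0 for every word
    a1 ... ap.

    In the nilCoxeter algebra, Fomin and Stanley's product of the factors
    1 + x_i u_a is the generating function of the Schubert polynomials, and the
    Yang-Baxter relation gives d_a S_w = S_{w s_a} if this shortens w, and 0
    otherwise.  Hence e d_a1 ... d_ap is dual to the Schubert polynomials when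
    a1 ... ap runs over one reduced word for each permutation, and Monk's rule
      x_k S_u = sum_(u -> v = u (a,b)) ([k = a] - [k = b]) S_v   modulo J
    follows by induction on the length of u, since J contains every f such that
    e(f) = 0 and all d_a f lie in J.  Working modulo J keeps everything inside S_n.

    Iterating Monk's rule, (sum_k y_k x_k)^p / p! = sum_w D_{1,w}(y) S_w(x)
    modulo J.  Pairing with f(y), homogeneous of degree p, gives
    f = sum_w <f, D_{1,w}> S_w modulo J; take f = S_u and apply the functionals
    dual to the S_w. *)

(** * Length and exchange *)

Section Length.
Variable n : nat.
Implicit Types (u v w : {perm 'I_n}) (a b c d : 'I_n) (s : seq 'I_n).

Local Notation len := (@perm_length n).

Lemma stpK a : (stp a * stp a = 1)%g.
Proof. by rewrite /stp; case: ifP => _; rewrite ?tperm2 ?mulg1. Qed.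

Lemma stpV a : (stp a)^-1%g = stp a.
Proof. by apply/eqP; rewrite eq_invg_mul stpK. Qed.

Lemma stpKl a w : (stp a * (stp a * w) = w)%g.
Proof. by rewrite mulgA stpK mul1g. Qed.

Lemma stp_eq a : (0 < a)%N -> stp a = tperm (pred_ord a) a.
Proof. by rewrite /stp => ->. Qed.

Lemma pred_ord_neq a : (0 < a)%N -> (pred_ord a == a) = false.
Proof. by move=> a0; apply/eqP => /(congr1 val) /=; lia. Qed.

Lemma stp_ltn a c d : (0 < a)%N -> (c < d)%N ->
  ((c == pred_ord a) && (d == a)) = false -> (stp a c < stp a d)%N.
Proof.
move=> a0 cd; rewrite stp_eq // -!val_eqE /= => ne.
have val_neq (x y : 'I_n) : x <> y -> val x <> val y by move=> nxy /val_inj.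
by case: tpermP => [ec|ec|/val_neq/= nc1 /val_neq/= nc2];
  case: tpermP => [ed|ed|/val_neq/= nd1 /val_neq/= nd2];
  move: cd ne; rewrite ?ec ?ed /=; lia.
Qed.

Lemma word_perm_cat s1 s2 :
  word_perm (s1 ++ s2) = (word_perm s2 * word_perm s1)%g.
Proof.
by elim: s1 => [|a s1 IH] /=; rewrite ?mulg1 // IH mulgA.
Qed.

Lemma word_perm_rcons s a : word_perm (rcons s a) = (stp a * word_perm s)%g.
Proof. by rewrite -cats1 word_perm_cat /= mul1g. Qed.

Lemma is_word_cat v w s t : is_word v s -> is_word w t -> is_word (w * v)%g (s ++ t).
Proof.
move=> /andP[s0 /eqP <-] /andP[t0 /eqP <-].
by rewrite /is_word all_cat s0 t0 word_perm_cat eqxx.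
Qed.

Lemma is_word_stp a : (0 < a)%N -> is_word (stp a) [:: a].
Proof. by move=> a0; rewrite /is_word /= a0 mul1g eqxx. Qed.

(** Induction on d - c: conjugating the transposition of c and d - 1 by s_d gives that of c and
    d. *)
Lemma tperm_has_word c d : (c < d)%N -> exists s, is_word (tperm c d) s.
Proof.
move: {2}(d - c)%N (erefl (d - c)%N) => m; elim: m d => [|m IH] d; first by lia.
move=> dc cd; have d0 : (0 < d)%N by lia.
have [e|ne] := eqVneq (val c) (val (pred_ord d)).
  exists [:: d]; have -> : c = pred_ord d by apply: val_inj.
  by rewrite -stp_eq //; apply: is_word_stp.
have [||s Hs] := IH (pred_ord d).
- by move: ne => /=; lia.
- by move: ne => /=; lia.
exists ([:: d] ++ (s ++ [:: d])).
have -> : tperm c d = (stp d * tperm c (pred_ord d) * stp d)%g.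
  have -> : tperm c d = (tperm c (pred_ord d) ^ stp d)%g.
    rewrite tpermJ stp_eq // tpermL tpermD //; apply/eqP => /(congr1 val) /=;
    by [move: ne => /=; lia|lia].
  by rewrite /conjg stp_eq // tpermV mulgA.
by do 2?apply: is_word_cat => //; apply: is_word_stp.
Qed.

Lemma perm_has_word w : exists s, is_word w s.
Proof.
have [ts -> Hts] := prod_tpermP w; elim: ts Hts => [|[c d] ts IH] /=.
  by move=> _; exists [::]; rewrite big_nil /is_word /= eqxx.
move=> /andP[/= ncd /IH[s Hs]]; rewrite big_cons.
have [t Ht] : exists t, is_word (tperm c d) t.
  have [lt|gt|/val_inj e] := ltngtP c d; first exact: tperm_has_word.
    by rewrite tpermC; apply: tperm_has_word.
  by rewrite /dpair /= e eqxx in ncd.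
by exists (s ++ t); apply: is_word_cat.
Qed.

(** Every permutation has a word, so the default value 0 of [perm_length] is never taken. *)
Lemma perm_length_spec w :
  (exists2 s, is_word w s & size s = len w) /\
  (forall s, is_word w s -> (len w <= size s)%N).
Proof.
have sizeP s : is_word w s -> has_word_of_size w (size s).
  by move=> ws; apply/existsP; exists (in_tuple s).
rewrite /perm_length.
case: ClassicalEpsilon.excluded_middle_informative => [H|]; last first.
  by case: (perm_has_word w) => s /sizeP ? []; exists (size s).
case: ex_minnP => p /existsP[t wt] pmin; split; last by move=> s /sizeP/pmin.
by exists t; rewrite ?size_tuple.
Qed.

Lemma perm_length_min w s : is_word w s -> (len w <= size s)%N.
Proof. by case: (perm_length_spec w) => _; apply. Qed.

Lemma reduced_word_exists w : exists s, is_reduced_word w s.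
Proof.
case: (perm_length_spec w) => -[s ws sz] _.
by exists s; rewrite /is_reduced_word ws sz eqxx.
Qed.

Lemma perm_length1 : len 1%g = 0%N.
Proof.
have := @perm_length_min 1%g [::]; rewrite leqn0 => H.
by apply/eqP/H; rewrite /is_word /= eqxx.
Qed.

Lemma perm_length_eq0 w : (len w == 0%N) = (w == 1%g).
Proof.
apply/eqP/eqP => [l0|->]; last exact: perm_length1.
case: (perm_length_spec w) => -[s]; rewrite l0 => /andP[_ /eqP <-] /size0nil -> //.
Qed.

Lemma perm_length_stp_le a w : (0 < a)%N -> (len (stp a * w)%g <= (len w).+1)%N.
Proof.
move=> a0; case: (perm_length_spec w) => -[s ws <-] _.
have := perm_length_min (is_word_cat ws (is_word_stp a0)).
by rewrite size_cat addn1.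
Qed.

(* Strong exchange: while the letters of a word act one after the other on the
   pair c < d, the letter at which the pair gets inverted is the one to delete. *)
Lemma word_exchange s c d : (c < d)%N -> (word_perm s d < word_perm s c)%N ->
  all (fun a : 'I_n => 0 < a)%N s ->
  exists2 s', is_word (tperm c d * word_perm s)%g s' & size s = (size s').+1.
Proof.
elim/last_ind: s c d => [|s a IH] c d cd /=; first by rewrite !perm1; lia.
rewrite all_rcons !word_perm_rcons !permM => lt /andP[a0 sa].
have [/andP[/eqP -> /eqP ->]|ne] := boolP ((c == pred_ord a) && (d == a)).
  exists s; last by rewrite size_rcons.
  by rewrite -stp_eq // stpKl /is_word sa eqxx.
have [||//|s' ws' sz] := IH (stp a c) (stp a d).
- by apply: stp_ltn => //; apply: negbTE.
- by [].
exists (rcons s' a); last by rewrite !size_rcons sz.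
have -> : (tperm c d * (stp a * word_perm s) =
           stp a * (tperm (stp a c) (stp a d) * word_perm s))%g.
  by rewrite -tpermJ /conjg -!mulgA mulKVg.
by rewrite -cats1; apply: is_word_cat => //; apply: is_word_stp.
Qed.

Lemma perm_length_tperm_lt w c d : (c < d)%N -> (w d < w c)%N ->
  (len (tperm c d * w)%g < len w)%N.
Proof.
move=> cd; case: (perm_length_spec w) => -[s /andP[s0 /eqP <-] <-] _ lt.
by have [s' ws' ->] := word_exchange cd lt s0; apply: perm_length_min.
Qed.

Lemma perm_length_tperm_gt w c d : (c < d)%N -> (w c < w d)%N ->
  (len w < len (tperm c d * w)%g)%N.
Proof.
move=> cd lt; rewrite -{1}[w](mulKg (tperm c d)) tpermV.
by apply: perm_length_tperm_lt; rewrite // !permM tpermL tpermR.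
Qed.

Lemma perm_length_tpermE w c d : (c < d)%N ->
  (len w < len (tperm c d * w)%g)%N = (w c < w d)%N.
Proof.
move=> cd; have [lt|gt|/val_inj/perm_inj e] := ltngtP (w c) (w d).
- exact: perm_length_tperm_gt.
- by have := perm_length_tperm_lt cd gt; lia.
- by rewrite e ltnn in cd.
Qed.

(** The length moves by at most one either way, and comparing the values of w at the two exchanged
    positions rules out equality. *)
Lemma perm_length_stp_cases a w : (0 < a)%N ->
  (len (stp a * w)%g = (len w).+1) \/ ((len (stp a * w)%g).+1 = len w).
Proof.
move=> a0; have le1 := perm_length_stp_le w a0.
have le2 := perm_length_stp_le (stp a * w)%g a0; rewrite stpKl in le2.
have cd : (pred_ord a < a)%N by rewrite /=; lia.
have [lt|gt|/val_inj/perm_inj/eqP] := ltngtP (w (pred_ord a)) (w a).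
- by left; apply/eqP; rewrite eqn_leq le1 stp_eq // perm_length_tperm_gt.
- by right; apply/eqP; rewrite eqn_leq le2 stp_eq // perm_length_tperm_lt.
- by rewrite pred_ord_neq.
Qed.

End Length.

(** * The nilCoxeter algebra *)

Section NilCoxeter.
Variables (R : comNzRingType) (E : algType R) (n : nat) (u : nat -> E).
Hypothesis u_sq : forall a, u a * u a = 0.
Hypothesis u_far : forall a b, (a.+1 < b)%N -> u a * u b = u b * u a.
Hypothesis u_braid : forall a, u a * u a.+1 * u a = u a.+1 * u a * u a.+1.
(** Factors with letters past n - 1 become 1, so [desc_prodS] holds for every k. *)
Hypothesis u_oversize : forall a, (n <= a)%N -> u a = 0.

Lemma mul1D1B (x : R) (a : E) : a * a = 0 -> (1 + x *: a) * (1 - x *: a) = 1.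
Proof.
move=> aa; rewrite mulrBr mulr1 mulrDl mul1r -scalerAl -scalerAr aa !scaler0.
by rewrite addr0 addrK.
Qed.

(* The right-hand side is symmetric in x and y: this is the Yang-Baxter relation. *)
Lemma yang_baxter (x y : R) (a b : E) : a * a = 0 -> b * b = 0 ->
  a * b * a = b * a * b ->
  (1 - y *: b) * (1 + x *: a) * (1 + y *: b) * (1 + y *: a) =
  1 + (x + y) *: a + (x * y) *: (a * b - b * a).
Proof.
move=> aa bb aba.
have baba : b * a * b * a = 0 by rewrite -aba -mulrA aa mulr0.
have E1 : (1 - y *: b) * (1 + x *: a) * (1 + y *: b) =
  1 + x *: a + (x * y) *: (a * b - b * a) - (x * y * y) *: (b * a * b).
  have -> : (1 - y *: b) * (1 + x *: a) =
            1 + x *: a - y *: b - (x * y) *: (b * a).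
    rewrite mulrBl mul1r -scalerAl mulrDr mulr1 -scalerAr scalerDr scalerA.
    by rewrite opprD [y * x]mulrC addrA.
  rewrite mulrDr mulr1 -scalerAr !mulrBl !mulrDl mul1r -!scalerAl bb scaler0 subr0.
  rewrite scalerBr scalerDr !scalerA [y * _]mulrC [y * (x * y)]mulrC scalerBr.
  by rewrite !addrA (ACl (1*2*6*4*7*(3*5)))/= addNr addr0.
rewrite E1 mulrDr mulr1 -scalerAr !mulrBl !mulrDl mul1r -!scalerAl mulrBl.
rewrite aa scaler0 addr0 -[b * a * a]mulrA aa mulr0 subr0 baba scaler0 subr0.
rewrite aba [y *: (_ + _)]scalerDr scalerA [y * _]mulrC scalerDl.
by rewrite !addrA (ACl (1*2*5*3*(4*6)))/= addNr addr0.
Qed.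

(** The contribution (1 + x u_{n-1}) ... (1 + x u_{k+1}) of one variable: the variable of index k,
    counted from 0, goes only with letters a > k. *)
Definition desc_prod (k : nat) (x : R) : E :=
  \prod_(a <- rev (iota k.+1 (n - k.+1))) (1 + x *: u a).

Lemma desc_prodS k x :
  desc_prod k x = desc_prod k.+1 x * (1 + x *: u k.+1).
Proof.
rewrite /desc_prod; have [kn|kn] := ltnP k.+1 n.
  have -> : (n - k.+1 = (n - k.+2).+1)%N by lia.
  by rewrite /= rev_cons -cats1 big_cat big_seq1.
have -> : (n - k.+1 = 0)%N by lia.
have -> : (n - k.+2 = 0)%N by lia.
by rewrite u_oversize // scaler0 addr0 mulr1 !big_nil.
Qed.

Lemma desc_prodSV k x :
  desc_prod k.+1 x = desc_prod k x * (1 - x *: u k.+1).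
Proof. by rewrite [in RHS]desc_prodS -mulrA mul1D1B // mulr1. Qed.

Lemma desc_prod_far k x b : (b < k)%N -> GRing.comm (u b) (desc_prod k x).
Proof.
move=> bk; rewrite /desc_prod big_seq; apply: commr_prod => a.
rewrite mem_rev mem_iota => /andP[ka _]; apply: commrD; first exact: commr1.
by rewrite /GRing.comm -scalerAr -scalerAl u_far //; lia.
Qed.

(** Downward induction on k; the cofactor left by the Yang-Baxter relation is symmetric in the two
    variables. *)
Lemma desc_prod_comm k x y :
  desc_prod k x * desc_prod k y = desc_prod k y * desc_prod k x.
Proof.
move: {2}(n - k)%N (leqnn (n - k)) => d; elim: d k x y => [|d IH] k x y kd.
  have e : (n - k.+1 = 0)%N by lia.
  by rewrite /desc_prod e !big_nil.
(* The factor 1 + z u_{k+1} commutes with [desc_prod k.+2 t], which is [desc_prod k.+1 t] times 1 -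
   t u_{k+2}; the four factors left over form the product of [yang_baxter]. *)
have step z t : desc_prod k z * desc_prod k t =
  desc_prod k.+1 z * desc_prod k.+1 t *
   (1 + (z + t) *: u k.+1 + (z * t) *: (u k.+1 * u k.+2 - u k.+2 * u k.+1)).
  rewrite -yang_baxter // !(desc_prodS k) -!mulrA; congr (_ * _).
  have far := desc_prod_far t (ltnSn k.+1).
  rewrite (desc_prodS k.+1) -[RHS]mulrA [_ * ((1 - _) * _)]mulrA mul1D1B // mul1r.
  rewrite !mulrA; congr (_ * _ * _).
  by rewrite mulrDl mul1r mulrDr mulr1 -scalerAl -scalerAr far.
by rewrite !step IH; [rewrite [x + y]addrC [x * y]mulrC|lia].
Qed.

(** With A = [desc_prod k] and u = [u k.+1], commutativity turns the left side into A(x) A(y) ((1 -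
    y u) - (1 - x u)), and u u = 0 lets [desc_prod k.+1 y] replace A(y) in front of u. *)
Lemma desc_prod_exchange k x y :
  desc_prod k x * desc_prod k.+1 y - desc_prod k y * desc_prod k.+1 x =
  (x - y) *: (desc_prod k x * desc_prod k.+1 y * u k.+1).
Proof.
rewrite !desc_prodSV !mulrA [desc_prod k y * _]desc_prod_comm -mulrBr.
rewrite -[in RHS]mulrA mulrBl mul1r -scalerAl u_sq scaler0 subr0.
by rewrite scalerAr; congr (_ * _); rewrite opprB addrC addrA subrK scalerBl.
Qed.

(** The Fomin-Stanley product. The variables are arbitrary ring elements so that two of them can be
    exchanged. *)
Definition schub_prod (y : nat -> R) : E :=
  \prod_(k <- iota 0 n) desc_prod k (y k).

(** The exchange touches two adjacent factors only, where [desc_prod_exchange] applies; [u i.+1]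
    then commutes with all factors of larger index. Read entrywise, this is a divided difference
    equation. *)
Lemma schub_prod_exchange i (y y' : nat -> R) : (i.+1 < n)%N ->
  y' i = y i.+1 -> y' i.+1 = y i ->
  (forall k, k != i -> k != i.+1 -> y' k = y k) ->
  schub_prod y - schub_prod y' = (y i - y i.+1) *: (schub_prod y * u i.+1).
Proof.
move=> i_n yi yi1 yk.
have eq_iota : iota 0 n = iota 0 i ++ [:: i, i.+1 & iota i.+2 (n - i.+2)].
  rewrite -{1}(subnKC (ltnW (ltnW i_n))) iotaD add0n; congr (_ ++ _).
  by rewrite (_ : n - i = (n - i.+2).+2)%N //; lia.
rewrite /schub_prod eq_iota !big_cat !big_cons /= yi yi1.
have -> : \prod_(k <- iota 0 i) desc_prod k (y' k) =
          \prod_(k <- iota 0 i) desc_prod k (y k).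
  apply: eq_big_seq => k; rewrite mem_iota => /andP[_ ki].
  by rewrite yk //; apply/eqP; lia.
have -> : \prod_(k <- iota i.+2 (n - i.+2)) desc_prod k (y' k) =
          \prod_(k <- iota i.+2 (n - i.+2)) desc_prod k (y k).
  apply: eq_big_seq => k; rewrite mem_iota => /andP[ik _].
  by rewrite yk //; apply/eqP; lia.
set P := \prod_(k <- iota 0 i) _; set Q := \prod_(k <- iota i.+2 _) _.
have comQ : Q * u i.+1 = u i.+1 * Q.
  apply/esym; rewrite /Q big_seq; apply: commr_prod => k.
  by rewrite mem_iota => /andP[ik _]; apply: desc_prod_far.
rewrite -mulrBr -[in RHS]mulrA scalerAr; congr (_ * _).
rewrite !mulrA -mulrBl desc_prod_exchange -scalerAl; congr (_ *: _).
by rewrite -!mulrA comQ.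
Qed.

(** * Expansion of the product over subsequences *)

Fixpoint subs (T : Type) (s : seq T) : seq (seq T) :=
  if s is x :: s' then subs s' ++ map (cons x) (subs s') else [:: [::]].

Lemma prod1D_subs (T : Type) (s : seq T) (g : T -> E) :
  \prod_(x <- s) (1 + g x) = \sum_(z <- subs s) \prod_(x <- z) g x.
Proof.
elim: s => [|x s IH] /=; first by rewrite big_nil big_seq1 big_nil.
rewrite big_cons IH big_cat big_map mulrDl mul1r mulr_sumr /=; congr (_ + _).
by apply: eq_bigr => z _; rewrite big_cons.
Qed.

(* The pair (k, a) stands for the factor 1 + y_k u_a; the order of the factors
   is that of the compatible sequences: k increasing, then a decreasing. *)
Definition schub_seq : seq (nat * nat) :=
  [seq (k, a) | k <- iota 0 n, a <- rev (iota k.+1 (n - k.+1))].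

Lemma schub_prodE y : schub_prod y =
  \sum_(z <- subs schub_seq)
    (\prod_(x <- z) y x.1) *: (\prod_(x <- z) u x.2).
Proof.
have -> : schub_prod y = \prod_(x <- schub_seq) (1 + y x.1 *: u x.2).
  by rewrite big_allpairs_dep.
rewrite prod1D_subs; apply: eq_bigr => z _.
elim: z => [|x z IH]; first by rewrite !big_nil scale1r.
by rewrite !big_cons IH -scalerAl -scalerAr scalerA.
Qed.

End NilCoxeter.

Lemma mem_subs (T : eqType) (s z : seq T) : (z \in subs s) = subseq z s.
Proof.
elim: s z => [|x s IH] z /=; first by rewrite mem_seq1; case: z.
rewrite mem_cat IH; case: z => [|y z] /=; first by rewrite sub0seq.
case: eqP => [->|ne].
  rewrite mem_map ?IH; last by move=> ? ? [].
  by apply/orb_idl => sub; apply: subseq_trans sub; apply: subseq_cons.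
rewrite orbC; case: mapP => //= -[z' _ [e _]]; by case: ne.
Qed.

Lemma subs_uniq (T : eqType) (s : seq T) : uniq s -> uniq (subs s).
Proof.
elim: s => [|x s IH] //= /andP[xs us]; rewrite cat_uniq IH //=.
rewrite map_inj_uniq ?IH // => [|? ? []//]; rewrite andbT.
apply/hasPn => _ /mapP[z _ ->]; rewrite mem_subs; apply: contra xs.
by move=> /mem_subseq; apply; rewrite mem_head.
Qed.

(** * The regular representation of the nilCoxeter algebra and the Billey-Jockusch-Stanley
    formula *)

Section NilCoxeterMatrices.
Variable n : nat.
Implicit Types (v w : {perm 'I_n}) (a b : 'I_n) (s t : seq 'I_n).

Local Notation len := (@perm_length n).
Local Notation P := {mpoly rat[n]}.
Local Notation N := #|{perm 'I_n}|.-1.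

Lemma card_perm_prednK : #|{perm 'I_n}| = N.+1.
Proof. by rewrite prednK //; apply/card_gt0P; exists 1%g. Qed.

Definition pidx w : 'I_N.+1 := cast_ord card_perm_prednK (enum_rank w).
Definition perm_at (i : 'I_N.+1) : {perm 'I_n} :=
  enum_val (cast_ord (esym card_perm_prednK) i).

Lemma pidxK w : perm_at (pidx w) = w.
Proof. by rewrite /perm_at /pidx cast_ordK enum_rankK. Qed.

Lemma perm_atK i : pidx (perm_at i) = i.
Proof. by rewrite /perm_at /pidx enum_valK cast_ordKV. Qed.

(** The generator u_a in the right regular representation, on row vectors: the basis vector of w
    goes to that of w s_a if this is longer, and to 0 otherwise. Outside 0 < a < n the matrix is
    0. *)
Definition nil_mx (a : nat) : 'M[P]_N.+1 :=
  if insub a is Some a' then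
    \matrix_(i, j) [&& (0 < a)%N, perm_at j == (stp a' * perm_at i)%g
                     & len (perm_at j) == (len (perm_at i)).+1]%:R
  else 0.

Lemma nil_mx_oversize (a : nat) : (n <= a)%N -> nil_mx a = 0.
Proof. by move=> na; rewrite /nil_mx insubF // ltnNge na. Qed.

Lemma nil_mx0 : nil_mx 0 = 0.
Proof.
rewrite /nil_mx; case: insubP => // a' _ _.
by apply/matrixP => i j; rewrite !mxE.
Qed.

Lemma perm_length_word_le s v : all (fun a : 'I_n => 0 < a)%N s ->
  (len (word_perm s * v)%g <= len v + size s)%N.
Proof.
elim: s v => [|a s IH] v /=; first by rewrite mul1g addn0.
move=> /andP[a0 s0]; rewrite -mulgA; apply: leq_trans (IH _ s0) _.
by rewrite addnS -addSn leq_add2r perm_length_stp_le.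
Qed.

(** A letter raises the length by at most one, so the total gain equals the size of the word only if
    every letter raises it: the length of the end point alone decides the entry. *)
Lemma prod_nil_mx s i j : all (fun a : 'I_n => 0 < a)%N s ->
  (\prod_(a <- s) nil_mx a) i j =
  ((perm_at j == (word_perm s * perm_at i)%g) &&
    (len (perm_at j) == len (perm_at i) + size s)%N)%:R.
Proof.
elim: s i => [|a s IH] i /=.
  move=> _; rewrite big_nil mul1g addn0 mxE eq_sym; congr ((nat_of_bool _)%:R).
  apply/idP/idP => [/eqP ->|/andP[/eqP ji _]]; first by rewrite !eqxx.
  by apply/eqP; rewrite -[i]perm_atK -[j]perm_atK ji.
move=> /andP[a0 s0]; rewrite big_cons mxE (bigD1 (pidx (stp a * perm_at i)%g)) //=.
rewrite [X in _ + X]big1 ?addr0 => [|k ki].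
  rewrite IH // pidxK /nil_mx valK mxE pidxK eqxx a0 /= mulgA -natrM mulnb.
  congr ((nat_of_bool _)%:R); rewrite andbCA; case: eqP => //= e.
  have le1 := perm_length_stp_le (perm_at i) a0.
  have := perm_length_word_le (stp a * perm_at i)%g s0; rewrite mulgA -e => le2.
  apply/andP/eqP => [[/eqP -> /eqP ->]|e2]; first by rewrite addSnnS.
  move: le2; rewrite e2 addnS -addSn leq_add2r => le2.
  have -> : len (stp a * perm_at i)%g = (len (perm_at i)).+1.
    by apply/eqP; rewrite eqn_leq le1.
  by rewrite addSnnS eqxx.
rewrite /nil_mx valK mxE; have [e|_] := eqVneq (perm_at k) (stp a * perm_at i)%g.
  by case/negP: ki; rewrite -e perm_atK.
by rewrite /= andbF mul0r.
Qed.

Lemma prod_nil_mx_eq s t :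
  all (fun a : 'I_n => 0 < a)%N s -> all (fun a : 'I_n => 0 < a)%N t ->
  word_perm s = word_perm t -> size s = size t ->
  \prod_(a <- s) nil_mx a = \prod_(a <- t) nil_mx a.
Proof. by move=> s0 t0 e1 e2; apply/matrixP => i j; rewrite !prod_nil_mx // e1 e2. Qed.

Lemma nil_mx_letterP (a : nat) : nil_mx a = 0 \/ (exists2 a' : 'I_n, a = a' & (0 < a')%N).
Proof.
have [na|an] := leqP n a; first by left; apply: nil_mx_oversize.
have [->|a0] := posnP a; first by left; apply: nil_mx0.
by right; exists (Ordinal an).
Qed.

Lemma nil_mx_sq (a : nat) : nil_mx a * nil_mx a = 0.
Proof.
have [->|[{}a -> a0]] := nil_mx_letterP a; first by rewrite mul0r.
have -> : nil_mx a * nil_mx a = \prod_(b <- [:: a; a]) nil_mx b.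
  by rewrite !big_cons big_nil mulr1.
apply/matrixP => i j; rewrite prod_nil_mx /= ?a0 // mxE mul1g stpK mul1g.
case: eqP => [->|] //=; rewrite -{1}[len _]addn0 eqn_add2l //.
Qed.

Lemma stp_far a b : (a.+1 < b)%N -> (stp a * stp b = stp b * stp a)%g.
Proof.
move=> ab; have [a0|a0] := posnP a; first by rewrite /stp a0 mulg1 mul1g.
have b0 : (0 < b)%N by lia.
apply/commgP/conjg_fixP; rewrite [stp a]stp_eq // tpermJ stp_eq //.
by rewrite !tpermD //; apply/eqP => /(congr1 val) /=; rewrite ?ba; lia.
Qed.

Lemma nil_mx_far (a b : nat) : (a.+1 < b)%N ->
  nil_mx a * nil_mx b = nil_mx b * nil_mx a.
Proof.
have [->|[{}a -> a0]] := nil_mx_letterP a; first by rewrite mul0r mulr0.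
have [->|[{}b -> b0]] := nil_mx_letterP b; first by rewrite mul0r mulr0.
move=> ab; have := @prod_nil_mx_eq [:: a; b] [:: b; a].
rewrite !big_cons !big_nil !mulr1 /= a0 b0 !mul1g; apply => //.
by rewrite (stp_far ab).
Qed.

Lemma stp_braid a b : (0 < a)%N -> b = a.+1 :> nat ->
  (stp a * stp b * stp a = stp b * stp a * stp b)%g.
Proof.
move=> a0 ba; have b0 : (0 < b)%N by rewrite ba.
have pb : pred_ord b = a by apply: val_inj; rewrite /= ba.
have -> : (stp a * stp b * stp a = stp b ^ stp a)%g.
  by rewrite /conjg mulgA stpV.
have -> : (stp b * stp a * stp b = stp a ^ stp b)%g.
  by rewrite /conjg mulgA stpV.
rewrite [X in (X ^ _)%g]stp_eq // [X in _ = (X ^ _)%g]stp_eq // !tpermJ pb.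
rewrite !stp_eq // pb tpermR tpermL.
by rewrite !tpermD //; apply/eqP => /(congr1 val) /=; rewrite ?ba; lia.
Qed.

Lemma nil_mx_braid (a : nat) :
  nil_mx a * nil_mx a.+1 * nil_mx a = nil_mx a.+1 * nil_mx a * nil_mx a.+1.
Proof.
have [->|[{}a -> a0]] := nil_mx_letterP a; first by rewrite !(mul0r, mulr0).
have [->|[b ba b0]] := nil_mx_letterP a.+1; first by rewrite !(mul0r, mulr0).
rewrite ba; have := @prod_nil_mx_eq [:: a; b; a] [:: b; a; b].
rewrite !big_cons !big_nil !mulr1 /= a0 b0 !mul1g !mulrA; apply => //.
by rewrite (stp_braid a0).
Qed.

(** * Compatible sequences as sorted lists of pairs *)

Definition schub_lt : rel (nat * nat) :=
  fun x y => (x.1 < y.1)%N || ((x.1 == y.1) && (y.2 < x.2)%N).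

Lemma schub_lt_trans : transitive schub_lt.
Proof. by move=> [a b] [c d] [e f]; rewrite /schub_lt /=; lia. Qed.

Lemma schub_lt_irr : irreflexive schub_lt.
Proof. by move=> [a b]; rewrite /schub_lt /=; lia. Qed.

Lemma mem_schub_seq x : (x \in schub_seq n) = (x.1 < x.2 < n)%N.
Proof.
case: x => k a; apply/allpairsPdep/idP => /=.
  move=> [k' [a' [_]]]; rewrite mem_rev mem_iota => + [-> ->]; lia.
by move=> ka; exists k, a; rewrite mem_rev !mem_iota; split => //; lia.
Qed.

Lemma sorted_schub_seq : sorted schub_lt (schub_seq n).
Proof.
rewrite sorted_pairwise; last exact: schub_lt_trans.
rewrite /schub_seq; move: {2}n => d; elim: d 0%N => [|d IH] m //=.
rewrite pairwise_cat IH andbT; apply/andP; split.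
  apply/allrelP => _ _ /mapP[a _ ->] /allpairsPdep[k [b [+ _ ->]]].
  by rewrite mem_iota /schub_lt /= => /andP[->].
rewrite pairwise_map -sorted_pairwise; last first.
  by move=> a b c; rewrite /schub_lt /=; lia.
rewrite rev_sorted; apply: sub_sorted (iota_ltn_sorted _ _) => a b.
by rewrite /schub_lt /= ltnn eqxx.
Qed.

(** A strictly sorted list is determined by its members, so z is what filtering [schub_seq n] by
    membership in z returns. *)
Lemma subseq_schub_seq z : subseq z (schub_seq n) =
  sorted schub_lt z && all (fun x => x.1 < x.2 < n)%N z.
Proof.
apply/idP/andP => [sub|[sz az]].
  split; first exact: subseq_sorted schub_lt_trans _ _ sub sorted_schub_seq.
  by apply/allP => x /(mem_subseq sub); rewrite mem_schub_seq.
have -> : z = [seq x <- schub_seq n | x \in z]; last exact: filter_subseq.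
apply: (irr_sorted_eq schub_lt_trans schub_lt_irr) => //.
  exact: sorted_filter schub_lt_trans _ _ sorted_schub_seq.
move=> x; rewrite mem_filter mem_schub_seq.
by apply/esym/andb_idr => /(allP az).
Qed.

(** For consecutive entries, weak increase of j with equality only at a descent of a is exactly
    [schub_lt]. *)
Lemma compatibleE (a j : seq nat) : size a = size j ->
  compatible a j = sorted schub_lt (zip j a) && all (fun x => x.1 < x.2)%N (zip j a).
Proof.
move=> sz; rewrite /compatible sz eqxx /=.
have szz : size (zip j a) = size j by rewrite size_zip sz minnn.
rewrite andbC; congr andb.
  apply/allP/(sortedP (0%N, 0%N)) => H i.
    rewrite szz => lt; rewrite !nth_zip // /schub_lt /=.
    by have := H i; rewrite mem_iota /=; lia.
  rewrite mem_iota => /andP[_ lt]; have := H i.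
  by rewrite szz !nth_zip // /schub_lt /=; lia.
apply/allP/(all_nthP (0%N, 0%N)) => H i.
  by rewrite szz => lt; rewrite nth_zip //=; apply: H; rewrite mem_iota.
rewrite mem_iota => /andP[_ lt]; have := H i.
by rewrite szz nth_zip //; apply.
Qed.

Definition extend0 (y : 'I_n -> P) (k : nat) : P :=
  if insub k is Some k' then y k' else 0.

(** In the expansion over subsequences of [schub_seq n], the entry from 1 to w keeps those whose
    letters spell a reduced word of w; zipping indices with letters matches them with the compatible
    pairs. *)
Lemma schub_prod_entry (y : 'I_n -> P) w :
  schub_prod n nil_mx (extend0 y) (pidx 1%g) (pidx w) =
  \sum_(t : (len w).-tuple 'I_n | is_reduced_word w t)
    \sum_(j : (len w).-tuple 'I_n | compatible (map val t) (map val j))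
      \prod_(k <- j) y k.
Proof.
rewrite schub_prodE summxE.
pose G (z : seq (nat * nat)) := \prod_(x <- z) extend0 y x.1.
pose C (z : seq (nat * nat)) := [exists t : (len w).-tuple 'I_n,
   (map val t == map snd z) && is_reduced_word w t].
pose h (tj : (len w).-tuple 'I_n * (len w).-tuple 'I_n) :=
  zip (map val tj.2) (map val tj.1).
pose D (tj : (len w).-tuple 'I_n * (len w).-tuple 'I_n) :=
  is_reduced_word w tj.1 && compatible (map val tj.1) (map val tj.2).
have inj_val := inj_map (@ord_inj n).
have hsz (tj : (len w).-tuple 'I_n * (len w).-tuple 'I_n) :
    size (map val tj.1) = size (map val tj.2).
  by rewrite !size_map !size_tuple.
transitivity (\sum_(z <- [seq z <- subs (schub_seq n) | C z]) G z).
  rewrite big_filter [RHS]big_mkcond; apply: eq_big_seq => z.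
  rewrite mem_subs subseq_schub_seq => /andP[_ az]; rewrite mxE -/(G z).
  have [s sz s0] : exists2 s : seq 'I_n, map val s = map snd z &
                     all (fun a : 'I_n => 0 < a)%N s.
    elim: z az => [|x z IH] /=; first by exists [::].
    move=> /andP[/andP[x1 x2] /IH[s e s0]]; exists (Ordinal x2 :: s) => /=.
      by rewrite e.
    by rewrite s0 andbT; apply: leq_ltn_trans x1.
  have -> : \prod_(x <- z) nil_mx x.2 = \prod_(a <- s) nil_mx a.
    by rewrite -(big_map val predT) sz big_map.
  rewrite prod_nil_mx // !pidxK perm_length1 mulg1 add0n.
  have -> : C z = (w == word_perm s) && (len w == size s).
    apply/existsP/andP => [[t /andP[/eqP]]|[/eqP e /eqP e2]].
      rewrite -sz => /inj_val <- /andP[/andP[_ /eqP ->]].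
      by rewrite size_tuple eqxx.
    exists (tcast (esym e2) (in_tuple s)); rewrite val_tcast /= sz eqxx /=.
    by rewrite /is_reduced_word /is_word s0 -e eqxx e2 eqxx.
  by case: ifP => _; rewrite ?mulr1 ?mulr0.
rewrite pair_big_dep /= -/D.
transitivity (\sum_(z <- [seq h tj | tj <- enum D]) G z); last first.
  rewrite big_map big_enum /=; apply: eq_bigr => tj _; rewrite /G /h.
  transitivity (\prod_(k <- map fst (zip (map val tj.2) (map val tj.1))) extend0 y k).
    by rewrite big_map.
  rewrite -/(unzip1 _) unzip1_zip ?hsz // big_map.
  by apply: eq_bigr => k _; rewrite /extend0 valK.
apply: perm_big; apply: uniq_perm.
- apply/filter_uniq/subs_uniq.
  exact: sorted_uniq schub_lt_trans schub_lt_irr _ sorted_schub_seq.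
- rewrite map_inj_uniq ?enum_uniq // => tj1 tj2 e.
  have e1 : tj1.1 = tj2.1.
    apply/val_inj/inj_val; rewrite /= -[LHS](@unzip2_zip _ _ (map val tj1.2)) ?hsz //.
    by rewrite -/(h tj1) e unzip2_zip ?hsz.
  have e2 : tj1.2 = tj2.2.
    apply/val_inj/inj_val; rewrite /= -[LHS](@unzip1_zip _ _ _ (map val tj1.1)) ?hsz //.
    by rewrite -/(h tj1) e unzip1_zip ?hsz.
  by case: tj1 tj2 e1 e2 {e} => [? ?] [? ?] /= -> ->.
move=> z; rewrite mem_filter mem_subs subseq_schub_seq.
apply/andP/mapP => [[/existsP[t /andP[/eqP tz rt]] /andP[sz az]]|].
  have [j jz] : exists j : (len w).-tuple 'I_n, map val j = map fst z.
    have [s es] : exists s : seq 'I_n, map val s = map fst z.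
      elim: z az {tz sz} => [|x z IH] /=; first by exists [::].
      move=> /andP[/andP[x1 x2] /IH[s e]].
      by exists (Ordinal (ltn_trans x1 x2) :: s); rewrite /= e.
    have e : size s = len w.
      by rewrite -(size_map val) es size_map -(size_map snd) -tz size_map size_tuple.
    by exists (tcast e (in_tuple s)); rewrite val_tcast.
  have zE : z = h (t, j) by rewrite /h /= jz tz zip_unzip.
  exists (t, j) => //; rewrite mem_enum unfold_in /D /= rt compatibleE ?(hsz (t, j)) //.
  rewrite -[zip _ _]/(h (t, j)) -zE sz /=.
  by apply: sub_all az => x /andP[].
move=> [[t j]]; rewrite mem_enum unfold_in /D /= => /andP[rt].
rewrite compatibleE ?(hsz (t, j)) // -[zip _ _]/(h (t, j)) => /andP[so al] ->.
have tz : map val t = map snd (h (t, j)).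
  by rewrite -/(unzip2 _) unzip2_zip // (hsz (t, j)).
split; first by apply/existsP; exists t; rewrite rt tz eqxx.
rewrite so /=; apply/allP => x xh; rewrite (allP al) //=.
have : x.2 \in map val t by rewrite tz map_f.
by move=> /mapP[a _ ->]; apply: ltn_ord.
Qed.

End NilCoxeterMatrices.

(** * Divided differences *)

Section DividedDifference.
Variable n : nat.
Implicit Types (u v w : {perm 'I_n}) (a b k : 'I_n) (s : seq 'I_n).
Implicit Types f g h : {mpoly rat[n]}.

Local Notation len := (@perm_length n).
Local Notation P := {mpoly rat[n]}.
Local Notation root a := ('X_(pred_ord a) - 'X_a : {mpoly rat[n]}).

Lemma msymXU (p : {perm 'I_n}) k : msym p 'X_k = 'X_(p k) :> P.
Proof. by rewrite /msym mmapX mmap1U. Qed.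

(** Divisibility by the root holds for variables and passes to sums and, by the twisted Leibniz
    rule, to products. *)
Lemma divdiff_exists a f :
  exists g, root a * g == f - msym (stp a) f.
Proof.
pose Q f := exists g, root a * g == f - msym (stp a) f.
have QM f1 f2 : Q f1 -> Q f2 -> Q (f1 * f2).
  move=> [g1 /eqP e1] [g2 /eqP e2]; exists (g1 * f2 + msym (stp a) f1 * g2).
  rewrite mulrDr mulrA e1 mulrCA e2 mulrBl mulrBr addrA subrK msymM //.
have QD f1 f2 : Q f1 -> Q f2 -> Q (f1 + f2).
  move=> [g1 /eqP e1] [g2 /eqP e2]; exists (g1 + g2).
  by rewrite mulrDr e1 e2 msymD opprD addrACA.
have Q1 : Q 1 by exists 0; rewrite msym1 mulr0 subrr.
have QX k : Q 'X_k.
  rewrite /Q msymXU /stp; case: ifP => _; last by exists 0; rewrite perm1 mulr0 subrr.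
  case: tpermP => [->|->|_ _].
  - by exists 1; rewrite mulr1.
  - by exists (-1); rewrite mulrN1 opprB.
  - by exists 0; rewrite mulr0 subrr.
elim/mpolyind: f => [|c m f _ _ IH]; first by exists 0; rewrite msym0 mulr0 subrr.
apply: QD => //.
suff [g /eqP e] : Q 'X_[m] by exists (c *: g); rewrite msymZ -scalerBr -e scalerAr.
rewrite mpolyXE_id; apply: (big_ind Q) => // i _.
by elim: (m i) => [|d IHd]; rewrite ?expr0 // exprS; apply: QM.
Qed.

(** For a = 0 the root vanishes and the chosen quotient is arbitrary; only positive letters carry a
    divided difference. *)
Definition divdiff a f : P := xchoose (divdiff_exists a f).

Lemma divdiffP a f : root a * divdiff a f = f - msym (stp a) f.
Proof. exact/eqP/(xchooseP (divdiff_exists a f)). Qed.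

Lemma root_neq0 a : (0 < a)%N -> root a != 0.
Proof.
move=> a0; apply/eqP => /(congr1 (mcoeff U_(a)%MM)).
rewrite mcoeffB !mcoeffXU mcoeff0 eqxx pred_ord_neq // sub0r => /eqP.
Qed.

Lemma divdiff_eq a f g : (0 < a)%N ->
  root a * g = f - msym (stp a) f -> divdiff a f = g.
Proof. by move=> a0; rewrite -divdiffP => /(mulfI (root_neq0 a0)). Qed.

Lemma divdiffD a f g : (0 < a)%N -> divdiff a (f + g) = divdiff a f + divdiff a g.
Proof.
by move=> a0; apply: divdiff_eq; rewrite // mulrDr !divdiffP msymD opprD addrACA.
Qed.

Lemma divdiffZ a c f : (0 < a)%N -> divdiff a (c *: f) = c *: divdiff a f.
Proof.
by move=> a0; apply: divdiff_eq; rewrite // -scalerAr divdiffP msymZ scalerBr.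
Qed.

Lemma divdiffM a f g : (0 < a)%N ->
  divdiff a (f * g) = divdiff a f * g + msym (stp a) f * divdiff a g.
Proof.
move=> a0; apply: divdiff_eq => //.
by rewrite mulrDr mulrA divdiffP mulrCA divdiffP mulrBl mulrBr addrA subrK msymM.
Qed.

Lemma divdiffX a k : (0 < a)%N ->
  divdiff a 'X_k = (k == pred_ord a)%:R - (k == a)%:R.
Proof.
move=> a0; apply: divdiff_eq => //; rewrite msymXU stp_eq //.
case: tpermP => [->|->|/eqP/negbTE -> /eqP/negbTE ->].
- by rewrite eqxx pred_ord_neq // subr0 mulr1.
- by rewrite eqxx eq_sym pred_ord_neq // sub0r mulrN1 opprB.
- by rewrite !subrr mulr0.
Qed.

(** S_w is the entry from 1 to w of the Fomin-Stanley product and s_a exchanges two of its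
    variables, so [schub_prod_exchange] gives the quotient as an entry of the product times u_a. *)
Lemma divdiff_schubert a w : (0 < a)%N ->
  divdiff a (schubert w) =
  if (len (stp a * w)%g).+1 == len w then schubert (stp a * w)%g else 0.
Proof.
move=> a0; apply: divdiff_eq => //.
have -> : schubert w =
    schub_prod n (@nil_mx n) (extend0 (fun k => 'X_k)) (pidx 1%g) (pidx w).
  by rewrite schub_prod_entry.
have -> : msym (stp a) (schub_prod n (@nil_mx n) (extend0 (fun k => 'X_k))
                          (pidx 1%g) (pidx w)) =
  schub_prod n (@nil_mx n) (extend0 (fun k => 'X_(stp a k))) (pidx 1%g) (pidx w).
  rewrite !schub_prod_entry raddf_sum; apply: eq_bigr => t _.
  rewrite raddf_sum; apply: eq_bigr => j _.
  rewrite /= (big_morph _ (msymM (stp a)) (msym1 _ (stp a))).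
  by apply: eq_bigr => k _; apply: msymXU.
have ext (y : 'I_n -> P) k : extend0 y k = y k by rewrite /extend0 valK.
(* Variables count from 0 and letters from 1: s_a exchanges the variables of index a - 1 and a. *)
have pa1 : (pred_ord a).+1 = a by rewrite /= prednK.
have := @schub_prod_exchange _ _ n (@nil_mx n) (@nil_mx_sq n) (@nil_mx_far n)
   (@nil_mx_braid n) (@nil_mx_oversize n) (pred_ord a)
   (extend0 (fun k => 'X_k)) (extend0 (fun k => 'X_(stp a k))).
rewrite !pa1 !ext => /(_ (ltn_ord a)); rewrite stp_eq // tpermL tpermR => H.
have {H} := H erefl erefl.
set S := schub_prod _ _ _; set S' := schub_prod _ _ _ => H.
have -> : S (pidx 1%g) (pidx w) - S' (pidx 1%g) (pidx w) =
          (S - S') (pidx 1%g) (pidx w) by rewrite !mxE.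
rewrite H => [|k nk1 nk2]; last first.
  rewrite /extend0; case: insubP => // k' _ ek; congr 'X_(_).
  by rewrite tpermD //; [move: nk1|move: nk2]; rewrite -ek eq_sym.
(* Column w of u_a has at most one nonzero entry, in the row of w s_a. *)
rewrite mxE; congr (_ * _); rewrite mxE (bigD1 (pidx (stp a * w)%g)) //=.
rewrite [X in _ + X]big1 ?addr0 => [|i ni]; last first.
  rewrite /nil_mx valK mxE pidxK.
  have [e|_] := eqVneq w (stp a * perm_at i)%g; last by rewrite /= andbF mulr0.
  by case/negP: ni; rewrite e stpKl perm_atK.
rewrite /nil_mx valK mxE !pidxK a0 stpKl eqxx /= stp_eq // [len w == _]eq_sym.
case: eqP => _; rewrite ?mulr1 ?mulr0 //.
by rewrite /S schub_prod_entry.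
Qed.

Lemma dhomog_prod_vars s : \prod_(k <- s) 'X_k \is [in rat[n], (size s).-homog].
Proof.
elim: s => [|k s IH]; first by rewrite big_nil dhomog1.
by rewrite big_cons /= -add1n; apply: dhomogM => //; rewrite dhomogX /= mdeg1.
Qed.

Lemma schubert_homog w : schubert w \is [in rat[n], (len w).-homog].
Proof.
apply: rpred_sum => t _; apply: rpred_sum => j _.
by have := dhomog_prod_vars j; rewrite size_tuple.
Qed.

Lemma schubert1 : schubert 1%g = 1 :> P.
Proof.
rewrite /schubert /is_reduced_word; move: (@perm_length1 n).
move: (len 1%g) => p -> {p}.
rewrite (big_pred1 [tuple]) => [|t]; last first.
  by rewrite [t]tuple0 /is_word /= !eqxx.
rewrite (big_pred1 [tuple]) => [|t]; last by rewrite [t]tuple0; apply/esym/eqxx.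
by rewrite big_nil.
Qed.

Lemma schubert_coef0 w : (schubert w)@_0 = (w == 1%g)%:R.
Proof.
have [->|w1] := eqVneq w 1%g; first by rewrite schubert1 mcoeff1 eqxx.
apply: (dhomog_nemf_coeff (schubert_homog w)).
by rewrite /= mdeg0 eq_sym perm_length_eq0.
Qed.

(* For a word s = (a_1, ..., a_p), [divdiff_word s] is the composite of
   divided differences d_{a_1} o ... o d_{a_p}. *)
Definition divdiff_word s f := foldr divdiff f s.

Definition positive_word s := all (fun a : 'I_n => 0 < a)%N s.

Lemma divdiff_word_rcons s a f :
  divdiff_word (rcons s a) f = divdiff_word s (divdiff a f).
Proof. by rewrite /divdiff_word foldr_rcons. Qed.

Lemma divdiff_wordD s f g : positive_word s ->
  divdiff_word s (f + g) = divdiff_word s f + divdiff_word s g.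
Proof.
by elim: s => //= a s IH /andP[a0 /IH e]; rewrite e divdiffD.
Qed.

Lemma divdiff_wordZ s c f : positive_word s ->
  divdiff_word s (c *: f) = c *: divdiff_word s f.
Proof.
by elim: s => //= a s IH /andP[a0 /IH e]; rewrite e divdiffZ.
Qed.

(* These polynomials form the ideal generated by the symmetric polynomials
   without constant term, presented as the common kernel of the functionals
   dual to the Schubert basis of the coinvariant algebra. *)
Definition coinv_null f := forall s, positive_word s -> (divdiff_word s f)@_0 = 0.

Lemma coinv_null_divdiff a f : (0 < a)%N -> coinv_null f -> coinv_null (divdiff a f).
Proof.
move=> a0 Jf s s0; rewrite -divdiff_word_rcons; apply: Jf.
by rewrite /positive_word all_rcons a0.
Qed.

(** The last letter of a word acts first, so a nonempty word applied to f is a shorter word applied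
    to some d_a f. *)
Lemma coinv_null_intro f : f@_0 = 0 ->
  (forall a, (0 < a)%N -> coinv_null (divdiff a f)) -> coinv_null f.
Proof.
move=> f0 Jf s; case/lastP: s => [|s a]; first by [].
by rewrite /positive_word all_rcons divdiff_word_rcons => /andP[/Jf]; apply.
Qed.

Lemma coinv_nullZ c f : coinv_null f -> coinv_null (c *: f).
Proof. by move=> Jf s s0; rewrite divdiff_wordZ // mcoeffZ Jf // mulr0. Qed.

Lemma coinv_null0 : coinv_null 0.
Proof.
by move=> s s0; rewrite -[0](scale0r 0) divdiff_wordZ // mcoeffZ mul0r.
Qed.

Lemma coinv_nullD f g : coinv_null f -> coinv_null g -> coinv_null (f + g).
Proof. by move=> Jf Jg s s0; rewrite divdiff_wordD // mcoeffD Jf // Jg // addr0. Qed.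

Lemma coinv_nullN f : coinv_null f -> coinv_null (- f).
Proof. by rewrite -scaleN1r; apply: coinv_nullZ. Qed.

Lemma coinv_null_sum (I : Type) (r : seq I) (Q : pred I) (F : I -> P) :
  (forall i, Q i -> coinv_null (F i)) -> coinv_null (\sum_(i <- r | Q i) F i).
Proof.
move=> JF; apply: (big_ind coinv_null) => //; first exact: coinv_null0.
exact: coinv_nullD.
Qed.

(** By the twisted Leibniz rule, d_a (h f) is a combination of the null polynomials f and d_a f; the
    multiplier h has to vary in the induction. *)
Lemma coinv_nullMl h f : coinv_null f -> coinv_null (h * f).
Proof.
move=> Jf s; elim/last_ind: s h f Jf => [|s a IH] h f Jf.
  by move=> _ /=; rewrite rmorphM /= (Jf [::]) // mulr0.
rewrite /positive_word all_rcons divdiff_word_rcons => /andP[a0 s0].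
rewrite divdiffM // divdiff_wordD // mcoeffD !IH ?addr0 //.
exact: coinv_null_divdiff.
Qed.

End DividedDifference.

(** * Monk's rule *)

Section Monk.
Variable n : nat.
Implicit Types (u v w : {perm 'I_n}) (a b c d k : 'I_n) (s : seq 'I_n).
Implicit Types f g h : {mpoly rat[n]}.

Local Notation len := (@perm_length n).
Local Notation P := {mpoly rat[n]}.

Definition coinv_eq f g := coinv_null (f - g).

Lemma coinv_eq_refl f : coinv_eq f f.
Proof. by rewrite /coinv_eq subrr; apply: coinv_null0. Qed.

Lemma coinv_eq_sym f g : coinv_eq f g -> coinv_eq g f.
Proof. by move=> fg; rewrite /coinv_eq -opprB; apply: coinv_nullN. Qed.

Lemma coinv_eq_trans g f h : coinv_eq f g -> coinv_eq g h -> coinv_eq f h.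
Proof. by move=> fg gh; rewrite /coinv_eq -(subrK g f) -addrA; apply: coinv_nullD. Qed.

Lemma coinv_eqZ x f g : coinv_eq f g -> coinv_eq (x *: f) (x *: g).
Proof. by move=> fg; rewrite /coinv_eq -scalerBr; apply: coinv_nullZ. Qed.

Lemma coinv_eqMl h f g : coinv_eq f g -> coinv_eq (h * f) (h * g).
Proof. by move=> fg; rewrite /coinv_eq -mulrBr; apply: coinv_nullMl. Qed.

Lemma coinv_eq_sum (I : Type) (r : seq I) (Q : pred I) (F G : I -> P) :
  (forall i, Q i -> coinv_eq (F i) (G i)) ->
  coinv_eq (\sum_(i <- r | Q i) F i) (\sum_(i <- r | Q i) G i).
Proof. by move=> FG; rewrite /coinv_eq -sumrB; apply: coinv_null_sum. Qed.

Definition bruhat_cover u (q : 'I_n * 'I_n) : bool :=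
  (q.1 < q.2)%N && (len (tperm q.1 q.2 * u)%g == (len u).+1).

(** The coefficient of x_k in the weight of the cover; for the pair exchanged by s_a it is also d_a
    x_k. *)
Definition cover_sign k (q : 'I_n * 'I_n) : rat := (k == q.1)%:R - (k == q.2)%:R.

Lemma stp_tperm a c d u :
  (stp a * (tperm c d * u) = tperm (stp a c) (stp a d) * (stp a * u))%g.
Proof. by rewrite -tpermJ /conjg stpV -!mulgA stpKl. Qed.

Lemma stpKf a : involutive (stp a).
Proof. by move=> c; rewrite -permM stpK perm1. Qed.

(* Lifting property: conjugation by s_a preserves the order of every pair of
   positions other than the pair exchanged by s_a itself. *)
Lemma perm_length_lift a c d u : (0 < a)%N -> (c < d)%N ->
  (c, d) != (pred_ord a, a) ->
  (len (stp a * u)%g < len (stp a * (tperm c d * u))%g)%N =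
  (len u < len (tperm c d * u)%g)%N.
Proof.
move=> a0 cd; rewrite xpair_eqE => /negbTE ne.
rewrite stp_tperm !perm_length_tpermE //; last exact: stp_ltn.
by rewrite !permM !stpKf.
Qed.

Lemma divdiff_sum a (I : Type) (r : seq I) (Q : pred I) (F : I -> P) : (0 < a)%N ->
  divdiff a (\sum_(i <- r | Q i) F i) = \sum_(i <- r | Q i) divdiff a (F i).
Proof.
move=> a0; apply: (big_morph (divdiff a)) => [f g|]; first exact: divdiffD.
by rewrite -[0](scale0r 0) divdiffZ // !scale0r.
Qed.

Lemma divdiffXM a k f : (0 < a)%N ->
  divdiff a ('X_k * f) =
  cover_sign k (pred_ord a, a) *: f + 'X_(stp a k) * divdiff a f.
Proof.
move=> a0; rewrite divdiffM // msymXU divdiffX //; congr (_ + _).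
by rewrite mulrBl scalerBl !scaler_nat !mulr_natl.
Qed.

Definition monk_sum k u : P :=
  \sum_(q : 'I_n * 'I_n | bruhat_cover u q)
    cover_sign k q *: schubert (tperm q.1 q.2 * u)%g.

Lemma divdiff_monk_sum a k u : (0 < a)%N ->
  divdiff a (monk_sum k u) =
  \sum_(q : 'I_n * 'I_n | bruhat_cover u q &&
           ((len (stp a * (tperm q.1 q.2 * u))%g).+1 == len (tperm q.1 q.2 * u)%g))
    cover_sign k q *: schubert (stp a * (tperm q.1 q.2 * u))%g.
Proof.
move=> a0; rewrite divdiff_sum // [RHS]big_mkcondr; apply: eq_bigr => q _.
rewrite divdiffZ // divdiff_schubert //.
by case: ifP => _; rewrite ?scaler0.
Qed.

(** By lifting, s_a still lengthens every cover of u except u s_a itself, so d_a kills all other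
    terms. *)
Lemma divdiff_monk_sum_ascent a k u : (0 < a)%N ->
  len (stp a * u)%g = (len u).+1 ->
  divdiff a (monk_sum k u) = cover_sign k (pred_ord a, a) *: schubert u.
Proof.
move=> a0 asc; rewrite divdiff_monk_sum // (big_pred1 (pred_ord a, a)).
  by rewrite /= -stp_eq // stpKl.
move=> [c d]; rewrite /bruhat_cover /=.
have [[-> ->]|ne] := eqVneq (c, d) (pred_ord a, a).
  by rewrite -stp_eq // stpKl asc !eqxx /= ltn_predL a0.
apply/negP => /andP[/andP[cd /eqP e1] /eqP e2].
have := perm_length_lift u a0 cd ne; move: e2; rewrite asc e1 => -[->].
by rewrite ltnSn ltnNge leqW.
Qed.

(** Conjugation by s_a matches the surviving covers of u with the covers of u s_a, except for the
    one leading from u s_a back up to u; that one cancels the term in S_u. *)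
Lemma divdiff_monk_sum_descent a k u : (0 < a)%N ->
  (len (stp a * u)%g).+1 = len u ->
  divdiff a (monk_sum k u) =
  cover_sign k (pred_ord a, a) *: schubert u + monk_sum (stp a k) (stp a * u)%g.
Proof.
move=> a0 desc; rewrite divdiff_monk_sum //.
have pa_a : (pred_ord a < a)%N by rewrite /= ltn_predL.
rewrite /monk_sum [X in _ = _ + X](bigD1 (pred_ord a, a)) /=; last first.
  by rewrite /bruhat_cover /= pa_a -stp_eq // stpKl desc eqxx.
rewrite -stp_eq // stpKl addrA -scalerDl.
have -> : cover_sign k (pred_ord a, a) + cover_sign (stp a k) (pred_ord a, a) = 0.
  have sk x : (stp a k == x) = (k == stp a x) by rewrite (can2_eq (stpKf a) (stpKf a)).
  rewrite /cover_sign /= !sk stp_eq // tpermL tpermR.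
  by rewrite addrC addrA subrK subrr.
rewrite scale0r add0r.
have inj_s : injective (fun q : 'I_n * 'I_n => (stp a q.1, stp a q.2)).
  by move=> [c d] [c' d'] /= [/perm_inj -> /perm_inj ->].
rewrite [RHS](reindex_inj inj_s) /=; apply: eq_big => [[c d]|[c d] _] /=; last first.
  by rewrite -stp_tperm /cover_sign /= !(inj_eq perm_inj).
rewrite /bruhat_cover /= -stp_tperm desc.
have ltE : (stp a c < stp a d)%N && ((stp a c, stp a d) != (pred_ord a, a)) =
           (c < d)%N && ((c, d) != (pred_ord a, a)).
  have imp (x y : 'I_n) : (x < y)%N && ((x, y) != (pred_ord a, a)) ->
      (stp a x < stp a y)%N && ((stp a x, stp a y) != (pred_ord a, a)).
    move=> /andP[xy]; rewrite !xpair_eqE => /negbTE ne.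
    have lt := stp_ltn a0 xy ne; rewrite lt /=; apply/negP => /andP[/eqP e1 /eqP e2].
    have ex : x = a by rewrite -[x](stpKf a) e1 stp_eq // tpermL.
    have ey : y = pred_ord a by rewrite -[y](stpKf a) e2 stp_eq // tpermR.
    by move: xy; rewrite ex ey ltnNge ltnW.
  by apply/idP/idP => [/imp|/imp //]; rewrite !stpKf.
rewrite [RHS]andbAC ltE; have [cd|//] := boolP (c < d)%N; rewrite /=.
(* The pair of s_a itself gives no cover of u, since s_a shortens u. *)
have [e|ne] /= := eqVneq (c, d) (pred_ord a, a).
  move: e => [-> ->]; rewrite -stp_eq //; apply/negP => /andP[/eqP e _].
  by move: desc; rewrite e => /eqP; rewrite gtn_eqF.
have lift := perm_length_lift u a0 cd ne.
have := perm_length_stp_le (stp a * (tperm c d * u))%g a0; rewrite stpKl => le.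
apply/andP/eqP => [[/eqP -> /eqP [->]]//|e].
move: lift le; rewrite e -desc ltnSn => /esym lt le.
by have -> : len (tperm c d * u)%g = (len (stp a * u)%g).+2
  by apply/eqP; rewrite eqn_leq le.
Qed.

(* Monk's rule.  The discrepancy has no constant term and, by induction on the
   length of u, all its divided differences are null. *)
Lemma monk k u : coinv_eq ('X_k * schubert u) (monk_sum k u).
Proof.
have [m lu] : exists m, (len u < m)%N by exists (len u).+1.
elim: m k u lu => [//|m IH] k u lu; apply: coinv_null_intro => [|a a0].
  rewrite mcoeffB rmorphM /= mcoeffX mnm1_eq0 mul0r sub0r; apply/eqP.
  rewrite oppr_eq0; apply/eqP; rewrite /monk_sum raddf_sum big1 // => q.
  move=> /andP[_ /eqP lq]; rewrite /= mcoeffZ schubert_coef0.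
  by rewrite -perm_length_eq0 lq mulr0.
have -> : divdiff a ('X_k * schubert u - monk_sum k u) =
          divdiff a ('X_k * schubert u) - divdiff a (monk_sum k u).
  by rewrite divdiffD // -scaleN1r divdiffZ // scaleN1r.
rewrite divdiffXM // divdiff_schubert //.
have [asc|desc] := perm_length_stp_cases u a0.
  rewrite divdiff_monk_sum_ascent // asc gtn_eqF 1?ltnW // mulr0 addr0 subrr.
  exact: coinv_null0.
rewrite divdiff_monk_sum_descent // desc eqxx opprD addrACA subrr add0r.
by apply: IH; rewrite desc.
Qed.

End Monk.

(** * Duality *)

Section Duality.
Variable n : nat.
Implicit Types (u v w : {perm 'I_n}) (a b c d k : 'I_n) (s : seq 'I_n).
Implicit Types f g h : {mpoly rat[n]}.
Implicit Types m : 'X_{1..n}.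

Local Notation len := (@perm_length n).
Local Notation P := {mpoly rat[n]}.

Definition mpair m g : rat := (mderivm m g)@_0.

Lemma mpairE m g : mpair m g = g@_m *+ \prod_(i < n) (m i)`!.
Proof.
rewrite /mpair mcoeff_mderivm addm0; congr (_ *+ _).
by apply: eq_bigr => i _; rewrite ffactnn.
Qed.

Lemma mpairD m f g : mpair m (f + g) = mpair m f + mpair m g.
Proof. by rewrite /mpair mderivmD mcoeffD. Qed.

Lemma mpairZ m x g : mpair m (x *: g) = x * mpair m g.
Proof. by rewrite /mpair mderivmZ mcoeffZ. Qed.

Lemma mpair_sum m (I : Type) (r : seq I) (Q : pred I) (F : I -> P) :
  mpair m (\sum_(i <- r | Q i) F i) = \sum_(i <- r | Q i) mpair m (F i).
Proof.
apply: (big_morph (mpair m)) => [f g|]; first exact: mpairD.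
by rewrite mpairE mcoeff0 mul0rn.
Qed.

(** Multiplication by x_k is adjoint to the derivative in x_k. If m k = 0, the truncated difference
    does no harm, its coefficient being 0. *)
Lemma mpairXM m k g : mpair m ('X_k * g) = (m k)%:R * mpair (m - U_(k))%MM g.
Proof.
elim/mpolyind: g => [|x m' g _ _ IH].
  by rewrite mulr0 -[0 : P](scale0r 0) !mpairZ !mul0r mulr0.
rewrite mulrDr !mpairD IH mulrDr; congr (_ + _).
rewrite -scalerAr !mpairZ mulrCA; congr (_ * _).
rewrite -mpolyXD !mpairE !mcoeffX; have [mk0|mk] := posnP (m k).
  rewrite mk0 mul0r; case: eqP => [e|]; last by rewrite mul0rn.
  by move: mk0; rewrite -e mnmDE mnm1E eqxx.
have leU : (U_(k) <= m)%MM by rewrite lep1mP -lt0n.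
have -> : ((U_(k) + m')%MM == m) = (m' == (m - U_(k))%MM).
  by apply/eqP/eqP => [<-|->]; rewrite addmC ?addmK ?submK.
case: eqP => _; last by rewrite !mul0rn mulr0.
rewrite !mulr1n -natrM; congr _%:R.
rewrite (bigD1 k) //= [X in _ = (_ * X)%N](bigD1 k) //= mulnA.
rewrite mnmBE mnm1E eqxx subn1; congr (_ * _)%N.
  by case: (m k) mk => // d _; rewrite factS.
by apply: eq_bigr => i ik; rewrite mnmBE mnm1E eq_sym (negbTE ik) subn0.
Qed.

(** Summing over all variables makes the signs of Monk's rule appear. *)
Lemma mpair_rootM m (q : 'I_n * 'I_n) g :
  mpair m (('X_q.1 - 'X_q.2) * g) =
  \sum_k (m k)%:R * (cover_sign k q * mpair (m - U_(k))%MM g).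
Proof.
have pick (i : 'I_n) (F : 'I_n -> rat) : \sum_k (k == i)%:R * F k = F i.
  rewrite (bigD1 i) //= eqxx mul1r big1 ?addr0 // => k /negbTE ->.
  by rewrite mul0r.
transitivity (\sum_k ((k == q.1)%:R * ((m k)%:R * mpair (m - U_(k))%MM g) -
                      (k == q.2)%:R * ((m k)%:R * mpair (m - U_(k))%MM g))).
  rewrite sumrB !pick mulrBl mpairD -scaleN1r mpairZ !mpairXM mulN1r //.
by apply: eq_bigr => k _; rewrite -mulrBl mulrCA.
Qed.

Lemma chain_sumS p u w : chain_sum p.+1 u w =
  \sum_(q : 'I_n * 'I_n | bruhat_cover u q)
    ('X_q.1 - 'X_q.2) * chain_sum p (tperm q.1 q.2 * u)%g w.
Proof. by rewrite /= pair_big_dep. Qed.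

Lemma chain_sum_homog p u w : chain_sum p u w \is [in rat[n], p.-homog].
Proof.
elim: p u => [|p IH] u; first by rewrite /=; case: (u == w); rewrite ?dhomog1 ?dhomog0.
rewrite chain_sumS; apply: rpred_sum => q _; rewrite -add1n.
by apply: dhomogM => //; apply: rpredB; rewrite dhomogX /= mdeg1.
Qed.

(* Iterating Monk's rule expands (sum_k y_k x_k)^p S_u on Schubert polynomials
   with the chain sums in y as coefficients; this is the coefficient of y^m. *)
Lemma chain_sum_schubert p u m : mdeg m = p ->
  coinv_eq (\sum_w mpair m (chain_sum p u w) *: schubert w)
           ((p`!)%:R *: ('X_[m] * schubert u)).
Proof.
elim: p u m => [|p IH] u m mp.
  move/eqP: mp; rewrite mdeg_eq0 => /eqP ->.
  rewrite mpolyX0 mul1r fact0 scale1r (bigD1 u) //= eqxx big1 => [|w wu].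
    by rewrite addr0 /mpair mderivm0m mcoeff1 eqxx scale1r; apply: coinv_eq_refl.
  by rewrite eq_sym (negbTE wu) /mpair mderivm0m mcoeff0 scale0r.
pose T k v := \sum_w mpair (m - U_(k))%MM (chain_sum p v w) *: schubert w.
have -> : \sum_w mpair m (chain_sum p.+1 u w) *: schubert w =
    \sum_k (m k)%:R *: \sum_(q : 'I_n * 'I_n | bruhat_cover u q)
                         cover_sign k q *: T k (tperm q.1 q.2 * u)%g.
  under eq_bigr => w _.
    rewrite chain_sumS mpair_sum.
    under eq_bigr => q _ do rewrite mpair_rootM.
    rewrite exchange_big scaler_suml /=.
    under eq_bigr => k _ do rewrite -mulr_sumr -scalerA scaler_suml.
    over.
  rewrite exchange_big; apply: eq_bigr => k _; rewrite -scaler_sumr; congr (_ *: _).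
  rewrite exchange_big; apply: eq_bigr => q _; rewrite /T scaler_sumr.
  by apply: eq_bigr => w _; rewrite scalerA.
(* (p + 1)! is p! times the sum of the exponents of m, which is p + 1. *)
have -> : ((p.+1)`!)%:R *: ('X_[m] * schubert u) =
          \sum_k (m k)%:R *: ((p`!)%:R *: ('X_[m] * schubert u)) :> P.
  by rewrite -scaler_suml -natr_sum -mdegE mp scalerA -natrM factS.
apply: coinv_eq_sum => k _; have [->|mk] := posnP (m k).
  by rewrite !scale0r; apply: coinv_eq_refl.
have leU : (U_(k) <= m)%MM by rewrite lep1mP -lt0n.
apply: coinv_eqZ.
(* Induction applies at each cover, with the monomial divided by x_k; Monk's rule then restores
   x_k. *)
apply: (@coinv_eq_trans _ (\sum_(q : 'I_n * 'I_n | bruhat_cover u q)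
   cover_sign k q *: ((p`!)%:R *: ('X_[m - U_(k)] * schubert (tperm q.1 q.2 * u)%g)))).
  apply: coinv_eq_sum => q _; apply: coinv_eqZ; apply: IH.
  by apply/eqP; rewrite -eqSS -mp -{2}(submK leU) mdegD mdeg1 addn1.
have -> : \sum_(q : 'I_n * 'I_n | bruhat_cover u q)
   cover_sign k q *: ((p`!)%:R *: ('X_[m - U_(k)] * schubert (tperm q.1 q.2 * u)%g)) =
   (p`!)%:R *: ('X_[m - U_(k)] * monk_sum k u).
  rewrite /monk_sum mulr_sumr scaler_sumr; apply: eq_bigr => q _.
  by rewrite -scalerAr !scalerA mulrC.
rewrite -{2}(submK leU) mpolyXD -mulrA; apply: coinv_eqZ; apply: coinv_eqMl.
exact/coinv_eq_sym/monk.
Qed.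

Lemma pairing_chain_sum p u f : f \is [in rat[n], p.-homog] ->
  coinv_eq (\sum_w diff_pairing f (chain_sum p u w) *: schubert w)
           ((p`!)%:R *: (f * schubert u)).
Proof.
move=> /dhomogP hf.
have -> : \sum_w diff_pairing f (chain_sum p u w) *: schubert w =
  \sum_(m <- msupp f) f@_m *: \sum_w mpair m (chain_sum p u w) *: schubert w.
  under eq_bigr => w _ do rewrite scaler_suml.
  rewrite exchange_big; apply: eq_bigr => m _; rewrite scaler_sumr.
  by apply: eq_bigr => w _; rewrite scalerA.
have -> : (p`!)%:R *: (f * schubert u) =
  \sum_(m <- msupp f) f@_m *: ((p`!)%:R *: ('X_[m] * schubert u)) :> P.
  rewrite {1}[f]mpolyE mulr_suml scaler_sumr; apply: eq_bigr => m _.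
  by rewrite -scalerAl !scalerA mulrC.
rewrite big_seq [X in coinv_eq _ X]big_seq; apply: coinv_eq_sum => m mf.
by apply/coinv_eqZ/chain_sum_schubert/hf.
Qed.

(** Peeling off the last letter a of s replaces v and w by v s_a and w s_a, and a prefix of a
    reduced word is reduced. If s_a does not shorten w, then w differs from v, which s_a does
    shorten. *)
Lemma divdiff_word_schubert s v w : is_reduced_word v s ->
  (divdiff_word s (schubert w))@_0 = (w == v)%:R.
Proof.
elim/last_ind: s v w => [|s a IH] v w /andP[/andP[s0 /eqP <-]].
  by move=> _; rewrite schubert_coef0.
move: s0; rewrite all_rcons word_perm_rcons size_rcons => /andP[a0 s0] /eqP sz.
have ws : is_word (word_perm s) s by rewrite /is_word s0 eqxx.
have lv : len (word_perm s) = size s.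
  apply/eqP; rewrite eqn_leq perm_length_min // -ltnS sz.
  exact: perm_length_stp_le.
rewrite divdiff_word_rcons divdiff_schubert //.
case: ifP => [_|ne].
  rewrite (IH (word_perm s)) /is_reduced_word ?ws ?lv ?eqxx //.
  by rewrite -(inj_eq (mulgI (stp a))) stpKl.
have -> : (divdiff_word s 0)@_0 = 0 by apply: coinv_null0.
have [e|//] := eqVneq w (stp a * word_perm s)%g.
by move: ne; rewrite e stpKl lv sz eqxx.
Qed.

(** As S_1 = 1, [pairing_chain_sum] expands p! S_u modulo J, and the functional of a reduced word of
    w reads off the coefficient at w. *)
Lemma pairing_schubert_chain_sum u w : len u = len w ->
  diff_pairing (schubert u) (chain_sum (len w) 1%g w) =
  ((len w)`!)%:R * (u == w)%:R.
Proof.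
move=> luw; have [s rs] := reduced_word_exists w.
have s0 : positive_word s by case/andP: rs => /andP[].
have hu := schubert_homog u; rewrite luw in hu.
have := pairing_chain_sum 1%g hu s0.
rewrite schubert1 mulr1 divdiff_wordD // -scaleN1r !divdiff_wordZ //.
rewrite mcoeffD !mcoeffZ (divdiff_word_schubert u rs) mulN1r => /eqP.
rewrite subr_eq0 => /eqP <-.
have -> : divdiff_word s (\sum_v diff_pairing (schubert u) (chain_sum (len w) 1%g v)
            *: schubert v) =
   \sum_v diff_pairing (schubert u) (chain_sum (len w) 1%g v)
            *: divdiff_word s (schubert v).
  rewrite (big_morph (divdiff_word s) (id1 := 0) (op1 := +%R)).
  - by apply: eq_bigr => v _; rewrite divdiff_wordZ.
  - by move=> f g; rewrite divdiff_wordD.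
  - by rewrite -[0](scale0r 0) divdiff_wordZ // !scale0r.
rewrite raddf_sum (bigD1 w) //= big1 => [|v vw].
  by rewrite addr0 mcoeffZ (divdiff_word_schubert w rs) eqxx mulr1.
by rewrite mcoeffZ (divdiff_word_schubert v rs) (negbTE vw) mulr0.
Qed.

End Duality.

Theorem theorem2 (n : nat) (u w : {perm 'I_n}) :
  diff_pairing (schubert u) (skew_dual_schubert 1%g w) = (u == w)%:R.
Proof.
rewrite /skew_dual_schubert perm_length1 subn0.
transitivity (((perm_length w)`!)%:R^-1 *
              diff_pairing (schubert u) (chain_sum (perm_length w) 1%g w)).
  rewrite /diff_pairing mulr_sumr; apply: eq_bigr => m _.
  by rewrite -[(_^`M[m])@_0]/(mpair m _) mpairZ mulrCA.
have [e|ne] := eqVneq (perm_length u) (perm_length w).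
  rewrite pairing_schubert_chain_sum // mulKf //.
  by rewrite Num.Theory.pnatr_eq0 -lt0n fact_gt0.
(* For different lengths the two polynomials are homogeneous of different degrees, and distinct
   monomials are orthogonal. *)
have -> : (u == w) = false by apply: contraNF ne => /eqP ->.
rewrite /diff_pairing big_seq big1 ?mulr0 // => m mu.
rewrite -[(_^`M[m])@_0]/(mpair m _) mpairE.
rewrite (dhomog_nemf_coeff (chain_sum_homog _ _ _)) ?mul0rn ?mulr0 //=.
by rewrite (dhomog_mf (schubert_homog u)).
Qed.
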